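(* Let $T_n\subseteq{}^{\omega>}2$ (for $n<\omega$) be trees with no maximal nodes, $\bar{T}=\langle T_n:n<\omega\rangle$, let $2\leq\iota<\omega$ and $k=2\iota$. Let $\mathbf{M}_{\bar{T},k}$, the relation $\sqsubseteq$, the translations $\mathbf{m}+\rho$, the rank ${\rm ndrk}$ and ${\rm NDRK}(\bar{T})$ be as defined in the context. Then: (1) The relation $\sqsubseteq$ is a partial order on $\mathbf{M}_{\bar{T},k}$. (2) If $\mathbf{m},\mathbf{n}\in\mathbf{M}_{\bar{T},k}$, $\mathbf{m}\sqsubseteq\mathbf{n}$ and $\alpha\leq{\rm ndrk}(\mathbf{n})$, then $\alpha\leq{\rm ndrk}(\mathbf{m})$. (3) The function ${\rm ndrk}$ is well defined (that is, if $\beta<\alpha$ and ${\rm ndrk}(\mathbf{m})\geq\alpha$, then ${\rm ndrk}(\mathbf{m})\geq\beta$). (4) If $\mathbf{m}\in\mathbf{M}_{\bar{T},k}$ and $\rho\in{}^{\omega}2$, then ${\rm ndrk}(\mathbf{m})={\rm ndrk}(\mathbf{m}+\rho)$. (5) If $\mathbf{m}\in\mathbf{M}_{\bar{T},k}$, $\nu\in u_{\mathbf{m}}$ and ${\rm ndrk}(\mathbf{m})\geq\omega_1$, then there is $\mathbf{n}\in\mathbf{M}_{\bar{T},k}$ such that $\mathbf{m}\sqsubseteq\mathbf{n}$, ${\rm ndrk}(\mathbf{n})\geq\omega_1$ and $|\{\eta\in u_{\mathbf{n}}:\nu\vartriangleleft\eta\}|\geq 2$. (6) If $\mathbf{m}\in\mathbf{M}_{\bar{T},k}$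 and $\infty>{\rm ndrk}(\mathbf{m})=\beta>\alpha$, then there is $\mathbf{n}\in\mathbf{M}_{\bar{T},k}$ such that $\mathbf{m}\sqsubseteq\mathbf{n}$ and ${\rm ndrk}(\mathbf{n})=\alpha$. (7) If ${\rm NDRK}(\bar{T})\geq\omega_1$, then ${\rm NDRK}(\bar{T})=\infty$. (8) Assume $\mathbf{m}\in\mathbf{M}_{\bar{T},k}$ and $u'\subseteq u_{\mathbf{m}}$, $|u'|\geq 2$. Put $\ell'=\ell_{\mathbf{m}}$, $h'_i=h^{\mathbf{m}}_i\restriction(u')^{\langle2\rangle}$ and $g'_i=g^{\mathbf{m}}_i\restriction(u')^{\langle2\rangle}$ (for $i<\iota$), and let $\mathbf{m}\restriction u'=(\ell',u',\bar{h}',\bar{g}')$ where $\bar h'=\langle h'_i:i<\iota\rangle$ and $\bar g'=\langle g'_i:i<\iota\rangle$. Then $\mathbf{m}\restriction u'\in\mathbf{M}_{\bar{T},k}$ and ${\rm ndrk}(\mathbf{m})\leq{\rm ndrk}(\mathbf{m}\restriction u')$.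
   Context: ${}^{\omega>}2$ is the set of finite 0-1 sequences, ${}^{\ell}2$ those of length $\ell$; $+$ is coordinatewise addition modulo 2; $\nu\vartriangleleft\eta$ means that $\nu$ is a proper initial segment of $\eta$. For a set $u$, $u^{\langle2\rangle}=\{(x,y)\in u\times u:x\neq y\}$. $\mathbf{M}_{\bar{T},k}$ consists of all tuples $\mathbf{m}=(\ell_{\mathbf{m}},u_{\mathbf{m}},\bar{h}_{\mathbf{m}},\bar{g}_{\mathbf{m}})=(\ell,u,\bar{h},\bar{g})$ such that: (a) $0<\ell<\omega$, $u\subseteq{}^{\ell}2$ and $2\leq|u|$; (b) $\bar{h}=\langle h_i:i<\iota\rangle$, $\bar{g}=\langle g_i:i<\iota\rangle$, with $h_i:u^{\langle2\rangle}\to\omega$ and $g_i:u^{\langle2\rangle}\to\bigcup_{n<\omega}(T_n\cap{}^{\ell}2)$ for each $i<\iota$; (c) $g_i(\eta,\nu)\in T_{h_i(\eta,\nu)}\cap{}^{\ell}2$ for all $(\eta,\nu)\in u^{\langle2\rangle}$, $i<\iota$; (d) $\eta+g_i(\eta,\nu)=\nu+g_i(\nu,\eta)$ for all $(\eta,\nu)\in u^{\langle2\rangle}$, $i<\iota$; (e) for any $(\eta,\nu)\in u^{\langle2\rangle}$ there are no repetitions in the sequence $\langle g_i(\eta,\nu),g_i(\nu,\eta):i<\iota\rangle$. The components of $\bar h_{\mathbf m},\bar g_{\mathbf m}$ are written $h^{\mathbf m}_i,g^{\mathbf m}_i$. Translations: for $\mathbf{m}=(\ell,u,\bar{h},\bar{g})\in\mathbf{M}_{\bar{T},k}$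 and $\rho\in{}^{\ell}2$, $\mathbf{m}+\rho=(\ell,u',\bar{h}',\bar{g}')$ where $u'=\{\eta+\rho:\eta\in u\}$, $h'_i(\eta+\rho,\nu+\rho)=h_i(\eta,\nu)$ and $g'_i(\eta+\rho,\nu+\rho)=g_i(\eta,\nu)$ for $(\eta,\nu)\in u^{\langle2\rangle}$, $i<\iota$. For $\rho\in{}^{\omega}2$, $\mathbf{m}+\rho=\mathbf{m}+(\rho\restriction\ell)$. Extension: $\mathbf{m}\sqsubseteq\mathbf{n}$ iff $\ell_{\mathbf{m}}\leq\ell_{\mathbf{n}}$, $u_{\mathbf{m}}=\{\eta\restriction\ell_{\mathbf{m}}:\eta\in u_{\mathbf{n}}\}$, and for every $(\eta,\nu)\in(u_{\mathbf{n}})^{\langle2\rangle}$ with $\eta\restriction\ell_{\mathbf{m}}\neq\nu\restriction\ell_{\mathbf{m}}$ and each $i<\iota$: $h^{\mathbf{m}}_i(\eta\restriction\ell_{\mathbf{m}},\nu\restriction\ell_{\mathbf{m}})=h^{\mathbf{n}}_i(\eta,\nu)$ and $g^{\mathbf{m}}_i(\eta\restriction\ell_{\mathbf{m}},\nu\restriction\ell_{\mathbf{m}})=g^{\mathbf{n}}_i(\eta,\nu)\restriction\ell_{\mathbf{m}}$. Rank ${\rm ndrk}:\mathbf{M}_{\bar{T},k}\to{\rm ON}\cup\{\infty\}$, defined by declaring inductively when ${\rm ndrk}(\mathbf{m})\geq\alpha$: ${\rm ndrk}(\mathbf{m})\geq0$ always; for limit $\alpha$, ${\rm ndrk}(\mathbf{m})\geq\alpha$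 iff ${\rm ndrk}(\mathbf{m})\geq\beta$ for all $\beta<\alpha$; ${\rm ndrk}(\mathbf{m})\geq\beta+1$ iff for every $\nu\in u_{\mathbf{m}}$ there is $\mathbf{n}\in\mathbf{M}_{\bar{T},k}$ with $\ell_{\mathbf{n}}>\ell_{\mathbf{m}}$, $\mathbf{m}\sqsubseteq\mathbf{n}$, ${\rm ndrk}(\mathbf{n})\geq\beta$ and $|\{\eta\in u_{\mathbf{n}}:\nu\vartriangleleft\eta\}|\geq2$; ${\rm ndrk}(\mathbf{m})=\infty$ iff ${\rm ndrk}(\mathbf{m})\geq\alpha$ for all ordinals $\alpha$ (otherwise ${\rm ndrk}(\mathbf m)$ is the largest $\alpha$ with ${\rm ndrk}(\mathbf m)\geq\alpha$). ${\rm NDRK}(\bar{T})=\sup\{{\rm ndrk}(\mathbf{m})+1:\mathbf{m}\in\mathbf{M}_{\bar{T},k}\}$ (with $\infty+1=\infty$). *)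

(* Defs.v *)
From HB Require Import structures.
From mathcomp Require Import all_boot finmap.
From mathcomp Require Import boolp classical_sets cardinality.

Set Implicit Arguments.
Unset Strict Implicit.
Unset Printing Implicit Defensive.

Local Open Scope quotient_scope.
Local Open Scope classical_set_scope.

(** * Ordinals *)

(* [Node f] denotes the least ordinal strictly above all the ordinals denoted
   by the [f a].  Every ordinal is denoted by some tree, since
   alpha = sup {beta + 1 : beta < alpha}, but not by a unique one: ordinals are
   obtained below as a quotient. *)
Inductive otree : Type := Node (A : Type) (f : A -> otree).

Fixpoint tle (s t : otree) {struct s} : Prop :=
  match s, t with
  | Node A f, Node B g => forall a : A, exists b : B, tle (f a) (g b)
  end.

Definition tlt (s t : otree) : Prop :=
  match t with Node B g => exists b : B, tle s (g b) end.

Lemma tle_refl s : tle s s.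
Proof. by elim: s => A f IH a /=; exists a; apply: IH. Qed.

Lemma tle_trans t s u : tle s t -> tle t u -> tle s u.
Proof.
elim: s t u => A f IH [B g] [C h] /= fg gh a.
have [b fab] := fg a; have [c gbc] := gh b.
by exists c; apply: IH gbc.
Qed.

Lemma tlt_le_trans t s u : tlt s t -> tle t u -> tlt s u.
Proof.
case: t u => [B g] [C h] /= [b sb] gh; have [c gbc] := gh b.
by exists c; apply: tle_trans gbc.
Qed.

Lemma tle_lt_trans t s u : tle s t -> tlt t u -> tlt s u.
Proof. by case: u => [C h] /= st [c tc]; exists c; apply: tle_trans tc. Qed.

Lemma tltW s t : tlt s t -> tle s t.
Proof.
elim: t s => B g IH [A f] /= [b fb] a; exists b; apply: IH.
by case: (g b) fb => C h /= /(_ a).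
Qed.

Lemma tle_total s t : tle s t \/ tlt t s.
Proof.
elim: s t => A f IH t.
have [|/existsNP[a nfa]] := pselect (forall a, tlt (f a) t).
  by case: t => B g H; left.
right; exists a; have [|//] : tle t (f a) \/ tlt (f a) t.
  elim: t nfa => B g IHt nfa.
  have [H|/existsNP[b ngb]] := pselect (forall b, tlt (g b) (f a)).
    by left; case: (f a) H => C h.
  by right; have [fg|//] := IH a (g b); exists b.
by [].
Qed.

Lemma tlt_wf : well_founded tlt.
Proof.
have H (t s : otree) : tle s t -> Acc tlt s.
  elim: t s => B g IH s sg; constructor => y ys.
  by have /= [b yb] := tlt_le_trans ys sg; apply: IH yb.
by move=> t; apply: H (tle_refl t).
Qed.

HB.instance Definition _ := gen_eqMixin otree.
HB.instance Definition _ := gen_choiceMixin otree.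

Definition teqb (s t : otree) : bool := `[< tle s t /\ tle t s >].

Lemma teqb_refl : reflexive teqb.
Proof. by move=> s; apply/asboolP; split; apply: tle_refl. Qed.

Lemma teqb_sym : symmetric teqb.
Proof. by move=> s t; apply/asboolP/asboolP => -[]. Qed.

Lemma teqb_trans : transitive teqb.
Proof.
move=> t s u /asboolP[st ts] /asboolP[tu ut]; apply/asboolP.
by split; [apply: tle_trans tu|apply: tle_trans ts].
Qed.

Canonical teqb_equiv := EquivRel teqb teqb_refl teqb_sym teqb_trans.

Definition ON := {eq_quot teqb}.

Definition ole (a b : ON) : Prop := tle (repr a) (repr b).
Definition olt (a b : ON) : Prop := tlt (repr a) (repr b).

Lemma repr_pi (t : otree) :
  tle (repr (\pi_ON t)) t /\ tle t (repr (\pi_ON t)).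
Proof. by have /eqmodP/asboolP := reprK (\pi_ON t). Qed.

Lemma ole_pi s t : ole (\pi_ON s) (\pi_ON t) <-> tle s t.
Proof.
have [s1 s2] := repr_pi s; have [t1 t2] := repr_pi t.
by split=> H; [apply: tle_trans t1|apply: tle_trans t2]; apply: tle_trans H.
Qed.

Lemma olt_pi s t : olt (\pi_ON s) (\pi_ON t) <-> tlt s t.
Proof.
have [s1 s2] := repr_pi s; have [t1 t2] := repr_pi t.
by split=> H; [apply: tlt_le_trans t1|apply: tlt_le_trans t2];
  apply: tle_lt_trans H.
Qed.

Lemma ole_refl a : ole a a.
Proof. exact: tle_refl. Qed.

Lemma ole_trans b a c : ole a b -> ole b c -> ole a c.
Proof. exact: tle_trans. Qed.

Lemma ole_anti a b : ole a b -> ole b a -> a = b.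
Proof.
move=> ab ba; rewrite -[a]reprK -[b]reprK.
by apply/eqmodP/asboolP.
Qed.

Lemma olt_le_trans b a c : olt a b -> ole b c -> olt a c.
Proof. exact: tlt_le_trans. Qed.

Lemma ole_lt_trans b a c : ole a b -> olt b c -> olt a c.
Proof. exact: tle_lt_trans. Qed.

Lemma oltW a b : olt a b -> ole a b.
Proof. exact: tltW. Qed.

Lemma ole_or_lt a b : ole a b \/ olt b a.
Proof. exact: tle_total. Qed.

Lemma olt_wf : well_founded olt.
Proof.
move=> a; move Et: (repr a) => t; elim: (tlt_wf t) a Et => {}t _ IH a Et.
by constructor => b ba; apply: IH (erefl (repr b)); rewrite -Et.
Qed.

Lemma olt_irr a : ~ olt a a.
Proof. by elim: (olt_wf a) => b _ IH bb; apply: (IH b). Qed.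

Definition ozero : ON := \pi_ON (Node (fun v : void => match v with end)).

Definition osucc (a : ON) : ON := \pi_ON (Node (fun _ : unit => repr a)).

Definition olimit (a : ON) : Prop := a <> ozero /\ forall b, a <> osucc b.

Lemma ozero_le a : ole ozero a.
Proof. by rewrite -(reprK a) /ozero ole_pi; case: (repr a) => A f []. Qed.

Lemma olt_succ a b : olt b (osucc a) <-> ole b a.
Proof.
rewrite -[in olt b _](reprK b) /osucc olt_pi /ole /=.
by split => [[]//|H]; exists tt.
Qed.

Lemma osucc_le a b : ole (osucc a) b <-> olt a b.
Proof.
rewrite -(reprK b) /osucc ole_pi -{2}(reprK a) olt_pi.
by case: (repr b) => B g /=; split => [/(_ tt)|].
Qed.

Definition oleast (P : set ON) : ON :=
  xget ozero [set a | P a /\ forall b, P b -> ole a b].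

Definition ogreatest (P : set ON) : ON :=
  xget ozero [set a | P a /\ forall b, P b -> ole b a].

Lemma oleastP (P : set ON) : (exists a, P a) ->
  P (oleast P) /\ forall b, P b -> ole (oleast P) b.
Proof.
move=> [a0 Pa0].
suff : exists a, P a /\ forall b, P b -> ole a b.
  by apply: (@xgetPex _ ozero [set a | P a /\ forall b, P b -> ole a b]).
elim: (olt_wf a0) Pa0 => a _ IH Pa.
have [[b ba Pb]|nex] := pselect (exists2 b, olt b a & P b); first exact: IH Pb.
exists a; split=> // b Pb; have [//|ba] := ole_or_lt a b.
by exfalso; apply: nex; exists b.
Qed.

Definition omega1 : ON := oleast [set a | ~ countable [set b | olt b a]].

(* Well-founded trees that are at most countably branching, used only to show
   that there is an uncountable ordinal. *)
Inductive ctree : Set := CNil | CNode (f : nat -> ctree).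

Fixpoint ctree_otree (c : ctree) : otree :=
  match c with
  | CNil => Node (fun v : void => match v with end)
  | CNode f => Node (fun n : nat => ctree_otree (f n))
  end.

Lemma uncountable_ordinal : exists a, ~ countable [set b | olt b a].
Proof.
exists (\pi_ON (Node ctree_otree)); move=> /countable_injP[f finj].
have below (b : ON) : olt b (\pi_ON (Node ctree_otree)) ->
    exists c, ole b (\pi_ON (ctree_otree c)).
  by rewrite -[b]reprK => /olt_pi[c bc]; exists c; apply/ole_pi.
have [g gP] : exists g : nat -> ctree, forall b,
    olt b (\pi_ON (Node ctree_otree)) -> ole b (\pi_ON (ctree_otree (g (f b)))).
  pose R n c := forall b, olt b (\pi_ON (Node ctree_otree)) -> f b = n ->
    ole b (\pi_ON (ctree_otree c)).
  have /choice[g gR] : forall n, exists c, R n c.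
    move=> n; have [[b bW fb]|nex] :=
        pselect (exists2 b, olt b (\pi_ON (Node ctree_otree)) & f b = n).
      have [c bc] := below b bW; exists c => b' b'W fb'.
      by rewrite (finj b' b) ?inE// fb' fb.
    by exists CNil => b bW fb; exfalso; apply: nex; exists b.
  by exists g => b bW; apply: (gR (f b) b).
pose w := \pi_ON (ctree_otree (CNode g)).
have wW : olt w (\pi_ON (Node ctree_otree)).
  by apply/olt_pi; exists (CNode g); apply: tle_refl.
apply: (@olt_irr w); apply: ole_lt_trans (gP w wW) _.
by apply/olt_pi; exists (f w); apply: tle_refl.
Qed.

Lemma omega1P : ~ countable [set b | olt b omega1] /\
  forall a, olt a omega1 -> countable [set b | olt b a].
Proof.
have [u l] := oleastP uncountable_ordinal; split=> // a aw.
by apply: contrapT => /l wa; apply: (@olt_irr a); apply: olt_le_trans wa.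
Qed.

(** * ON with a largest element adjoined *)

Inductive ONx : Type := Ord of ON | Inf.

Definition xle (x y : ONx) : Prop :=
  match x, y with
  | _, Inf => True
  | Inf, Ord _ => False
  | Ord a, Ord b => ole a b
  end.

Definition xsucc (x : ONx) : ONx := if x is Ord a then Ord (osucc a) else Inf.

Definition xsup (P : ONx -> Prop) : ONx :=
  if pselect (exists a, forall x, P x -> xle x (Ord a))
  then Ord (oleast [set a | forall x, P x -> xle x (Ord a)])
  else Inf.

(** * Finite 0-1 sequences *)

Local Open Scope fset_scope.
Local Open Scope fmap_scope.

Definition badd (x y : seq bool) : seq bool :=
  [seq p.1 (+) p.2 | p <- zip x y].

Definition pinit (x y : seq bool) : bool := prefix x y && (x != y).

Definition is_tree (T : seq bool -> Prop) : Prop :=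
  forall x y, prefix x y -> T y -> T x.

Definition no_maximal (T : seq bool -> Prop) : Prop :=
  forall x, T x -> exists2 y, T y & pinit x y.

Definition offdiag (u : {fset seq bool}) : {fset seq bool * seq bool} :=
  [fset p in u `*` u | p.1 != p.2].

(** * The tuples *)

(* [iot] is the length of the sequences h and g, so that k = 2 * iot.
   [hfun m i] and [gfun m i] are finite maps; for the elements of [inM] their
   domain is exactly [offdiag (nodes m)], so that equality of tuples is
   equality in the set-theoretic sense. *)
Record tup (iot : nat) : Type := Tup {
  lev : nat;
  nodes : {fset seq bool};
  hfun : {ffun 'I_iot -> {fmap seq bool * seq bool -> nat}};
  gfun : {ffun 'I_iot -> {fmap seq bool * seq bool -> seq bool}}
}.

Section Tuples.
Variable iot : nat.
Implicit Types m n : tup iot.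

(* Values of the maps; the default values are only reached off the domain. *)
Definition hv m (i : 'I_iot) (x y : seq bool) : nat :=
  odflt 0 (hfun m i).[? (x, y)].

Definition gv m (i : 'I_iot) (x y : seq bool) : seq bool :=
  odflt [::] (gfun m i).[? (x, y)].

Definition inM (T : nat -> seq bool -> Prop) m : Prop :=
  [/\ [/\ 0 < lev m, forall x, x \in nodes m -> size x = lev m
        & 2 <= #|` nodes m|],
      forall i, domf (hfun m i) = offdiag (nodes m) /\
                domf (gfun m i) = offdiag (nodes m),
      forall i x y, (x, y) \in offdiag (nodes m) ->
        T (hv m i x y) (gv m i x y) /\ size (gv m i x y) = lev m,
      forall i x y, (x, y) \in offdiag (nodes m) ->
        badd x (gv m i x y) = badd y (gv m i y x)
    & forall x y, (x, y) \in offdiag (nodes m) ->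
        uniq ([seq gv m i x y | i : 'I_iot] ++ [seq gv m i y x | i : 'I_iot])].

Definition extends m n : Prop :=
  [/\ lev m <= lev n,
      nodes m = [fset take (lev m) x | x in nodes n]
    & forall x y, (x, y) \in offdiag (nodes n) ->
        take (lev m) x != take (lev m) y ->
        forall i,
          hv m i (take (lev m) x) (take (lev m) y) = hv n i x y /\
          gv m i (take (lev m) x) (take (lev m) y) = take (lev m) (gv n i x y)].

(* At least two elements of [nodes n] properly extend [x]. *)
Definition splits n (x : seq bool) : Prop :=
  2 <= #|` [fset y in nodes n | pinit x y]|.

(* Adding [rho] is an involution of the sequences of length [size rho], hence
   h'(eta + rho, nu + rho) = h(eta, nu) reads h'(x, y) = h(x + rho, y + rho). *)
Definition trans_nodes m (rho : seq bool) : {fset seq bool} :=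
  [fset badd x rho | x in nodes m].

Definition translate m (rho : seq bool) : tup iot :=
  {| lev := lev m;
     nodes := trans_nodes m rho;
     hfun := [ffun i => [fmap p : offdiag (trans_nodes m rho) =>
       hv m i (badd (val p).1 rho) (badd (val p).2 rho)]];
     gfun := [ffun i => [fmap p : offdiag (trans_nodes m rho) =>
       gv m i (badd (val p).1 rho) (badd (val p).2 rho)]] |}.

Definition translateN m (rho : nat -> bool) : tup iot :=
  translate m (mkseq rho (lev m)).

Definition restrict m (u : {fset seq bool}) : tup iot :=
  {| lev := lev m;
     nodes := u;
     hfun := [ffun i => (hfun m i).[& offdiag u]];
     gfun := [ffun i => (gfun m i).[& offdiag u]] |}.

(* [ndrk_ge T a m] is the inductively declared relation ndrk(m) >= a. *)
Inductive ndrk_ge (T : nat -> seq bool -> Prop) : ON -> tup iot -> Prop :=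
| ndrk_ge_zero m : ndrk_ge T ozero m
| ndrk_ge_limit a m : olimit a ->
    (forall b, olt b a -> ndrk_ge T b m) -> ndrk_ge T a m
| ndrk_ge_succ b m :
    (forall x, x \in nodes m -> exists n,
       [/\ inM T n, lev m < lev n, extends m n, ndrk_ge T b n & splits n x]) ->
    ndrk_ge T (osucc b) m.

Definition ndrk (T : nat -> seq bool -> Prop) m : ONx :=
  if pselect (forall a, ndrk_ge T a m) then Inf
  else Ord (ogreatest [set a | ndrk_ge T a m]).

Definition NDRK (T : nat -> seq bool -> Prop) : ONx :=
  xsup (fun x => exists2 m, inM T m & x = xsucc (ndrk T m)).

End Tuples.

(* Main.v *)
(* Parts (2), (4) and (8) are simulation arguments: the rank does not decrease
   along a relation between tuples that lifts one-step splitting extensions.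
   For (5), each a < omega_1 yields an extension n of m splitting x with
   ndrk(n) >= a; as there are only countably many tuples, if all these n had
   countable rank then omega_1 would be a countable union of countable sets.
   Iterating (5), ndrk(m) >= omega_1 implies ndrk(m) = oo.  The same counting
   gives (7): if all ranks were countable, the countably many tuples could not
   have cofinal ranks below omega_1.  For (6), choose x witnessing that
   ndrk(m) >= b + 1 fails: the extensions splitting x have rank < b. *)

Require Import Defs.
From mathcomp Require Import all_boot finmap.
From mathcomp Require Import boolp classical_sets cardinality.

Set Implicit Arguments.
Unset Strict Implicit.
Unset Printing Implicit Defensive.

Local Open Scope fset_scope.

Lemma card_fset_gt1P (K : choiceType) (A : {fset K}) :
  (2 <= #|` A|)%N <-> exists x y, [/\ x \in A, y \in A & x != y].
Proof.
split=> [|[x [y [xA yA xy]]]].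
  have := fset_uniq A; have : enum_fset A =i A by [].
  case: (enum_fset A) => [|x [|y s]] //= eA /andP[xs _] _.
  exists x, y; rewrite -!eA !inE !eqxx orbT; split=> //.
  by apply: contraNneq xs => ->; rewrite inE eqxx.
have <- : #|` [fset x; y]| = 2 by rewrite cardfs2 xy.
by apply: fsubset_leq_card; apply/fsubsetP => z; rewrite !inE => /orP[]/eqP->.
Qed.

Lemma fmap_odflt_inj (K : choiceType) (V : Type) (d : V) (f g : {fmap K -> V}) :
  domf f = domf g ->
  (forall k, k \in domf g -> odflt d f.[? k]%fmap = odflt d g.[? k]%fmap) ->
  f = g.
Proof.
move=> fg H; apply/fmapP => k.
have [kg|kg] := boolP (k \in domf g); last first.
  have kf : k \notin domf f by rewrite fg.
  by rewrite (not_fnd kf) (not_fnd kg).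
have kf : k \in domf f by rewrite fg.
by have := H k kg; rewrite (in_fnd kf) (in_fnd kg) /= => ->.
Qed.

Lemma offdiagE (u : {fset seq bool}) x y :
  ((x, y) \in offdiag u) = [&& x \in u, y \in u & x != y].
Proof. by rewrite !inE /= andbA. Qed.

Lemma baddC x y : badd x y = badd y x.
Proof.
elim: x y => [|a x IH] [|b y] //.
by rewrite /badd /= addbC; congr cons; apply: IH.
Qed.

Lemma baddA x y z : badd x (badd y z) = badd (badd x y) z.
Proof.
elim: x y z => [|a x IH] [|b y] [|c z] //.
by rewrite /badd /= addbA; congr cons; apply: IH.
Qed.

Lemma baddK x y : size x = size y -> badd (badd x y) y = x.
Proof.
elim: x y => [|a x IH] [|b y] //= [E].
by rewrite /badd /= -addbA addbb addbF; congr cons; apply: IH.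
Qed.

Lemma size_badd x y : size x = size y -> size (badd x y) = size x.
Proof. by move=> E; rewrite size_map size_zip -E minnn. Qed.

Lemma take_badd n x y : take n (badd x y) = badd (take n x) (take n y).
Proof.
elim: n x y => [|n IH] [|a x] [|b y] //=.
by rewrite /badd /=; congr cons; apply: IH.
Qed.

Lemma pinit_take x y : (size x < size y)%N -> pinit x y = (take (size x) y == x).
Proof.
move=> xy; rewrite /pinit prefixE; case: eqP => //= _.
by apply: contraTneq xy => ->; rewrite ltnn.
Qed.

Lemma olt_osucc a : olt a (osucc a).
Proof. exact/olt_succ/ole_refl. Qed.

Lemma ole_neq_lt a b : ole a b -> a <> b -> olt a b.
Proof. by move=> ab nab; have [/(ole_anti ab)|] := ole_or_lt b a. Qed.

Lemma osucc_inj : injective osucc.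
Proof.
move=> a b E; apply: ole_anti; apply/olt_succ.
  by rewrite -E; apply: olt_osucc.
by rewrite E; apply: olt_osucc.
Qed.

Lemma osucc_neq0 a : osucc a <> ozero.
Proof.
move=> E; apply: (@olt_irr a); apply: olt_le_trans (ozero_le a).
by rewrite -E; apply: olt_osucc.
Qed.

Lemma ON_ind (P : ON -> Prop) : P ozero -> (forall b, P b -> P (osucc b)) ->
  (forall a, olimit a -> (forall b, olt b a -> P b) -> P a) -> forall a, P a.
Proof.
move=> P0 PS PL a; elim: (olt_wf a) => {}a _ IH.
have [->//|na0] := pselect (a = ozero).
have [[b E]|nS] := pselect (exists b, a = osucc b).
  by rewrite E; apply/PS/IH; rewrite E; apply: olt_osucc.
by apply: PL => //; split=> // b E; apply: nS; exists b.
Qed.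

Lemma ogreatestP (P : ON -> Prop) :
  (exists a, P a /\ forall b, P b -> ole b a) ->
  P (ogreatest P) /\ forall b, P b -> ole b (ogreatest P).
Proof.
exact: (@xgetPex _ ozero [set a | P a /\ forall b, P b -> ole b a]%classic).
Qed.

Lemma countable_ole a : olt a omega1 -> countable [set b | ole b a]%classic.
Proof.
move=> /(proj2 omega1P) ca.
have -> : [set b | ole b a]%classic =
    (\bigcup_(i in [set: bool]) if i then [set b | olt b a] else [set a])%classic.
  apply/seteqP; split=> b /= => [ba|[[] _] /=]; last 2 first.
  - exact: oltW.
  - by move=> ->; apply: ole_refl.
  have [->|nba] := pselect (b = a); first by exists false.
  by exists true => //; apply: ole_neq_lt.
by apply: bigcup_countable => // -[] _ //; apply: countable1.
Qed.

Lemma osucc_omega1 a : olt a omega1 -> olt (osucc a) omega1.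
Proof.
move=> aw; apply: ole_neq_lt; first exact/osucc_le.
move=> E; apply: (proj1 omega1P); rewrite -E.
have -> : [set b | olt b (osucc a)]%classic = [set b | ole b a]%classic.
  by apply/seteqP; split=> b /=; rewrite olt_succ.
exact: countable_ole.
Qed.

Lemma xle_anti x y : xle x y -> xle y x -> x = y.
Proof. by case: x y => [a|] [b|] //= ab ba; rewrite (ole_anti ab ba). Qed.

Section Tuples.
Variables (T : nat -> seq bool -> Prop) (iot : nat).
Implicit Types m n p : tup iot.

Lemma inM_size m x : inM T m -> x \in nodes m -> size x = lev m.
Proof. by case=> -[_ + _] _ _ _ _; apply. Qed.

Lemma countable_tup (A : set (tup iot)) : countable A.
Proof.
pose C : countType := (nat * {fset seq bool} *
  {ffun 'I_iot -> {fmap seq bool * seq bool -> nat}} *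
  {ffun 'I_iot -> {fmap seq bool * seq bool -> seq bool}})%type.
pose code m := choice.pickle ((lev m, nodes m, hfun m, gfun m) : C).
apply/countable_injP; exists code => -[l u h g] [l' u' h' g'] _ _.
by move=> /(pcan_inj choice.pickleK) [-> -> -> ->].
Qed.

Lemma splitsP n x : inM T n -> (size x < lev n)%N ->
  splits n x <-> exists y z, [/\ y \in nodes n, z \in nodes n, y != z,
    take (size x) y = x & take (size x) z = x].
Proof.
move=> Mn xn; rewrite /splits card_fset_gt1P.
have pin y : y \in nodes n -> pinit x y = (take (size x) y == x).
  by move=> yn; rewrite pinit_take // (inM_size Mn yn).
split=> -[y [z H]]; exists y, z; move: H.
  rewrite !inE => -[/andP[yn xy] /andP[zn xz] yz].
  by move: xy xz; rewrite !pin // => /eqP xy /eqP xz.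
by case=> yn zn yz xy xz; rewrite !inE yn zn !pin // xy xz eqxx.
Qed.

Lemma extends_refl m : inM T m -> extends m m.
Proof.
move=> Mm; have tk x : x \in nodes m -> take (lev m) x = x.
  by move=> xm; rewrite take_oversize // (inM_size Mm).
split=> // [|x y].
  apply/fsetP => x; apply/idP/imfsetP => /= [xm|[y ym ->]]; last by rewrite tk.
  by exists x; rewrite ?tk.
move=> xy _ i; have := xy; rewrite offdiagE => /and3P[xm ym _].
rewrite (tk x) // (tk y) //; split=> //.
by case: Mm => _ _ /(_ i _ _ xy)[_ gs] _ _; rewrite take_oversize // gs.
Qed.

Lemma extends_nodes m n x : extends m n -> x \in nodes n ->
  take (lev m) x \in nodes m.
Proof. by case=> _ -> _ xn; apply: in_imfset. Qed.

Lemma extends_lift m n x : extends m n -> x \in nodes m ->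
  exists2 y, y \in nodes n & x = take (lev m) y.
Proof. by case=> _ -> _ /imfsetP. Qed.

Lemma extends_anti m n : inM T m -> inM T n ->
  extends m n -> extends n m -> m = n.
Proof.
move=> Mm Mn mn [nm _ _]; case: (mn) => le_mn _ mnv.
have El : lev m = lev n by apply/eqP; rewrite eqn_leq le_mn nm.
have tk x : x \in nodes n -> take (lev m) x = x.
  by move=> xn; rewrite take_oversize // (inM_size Mn) // El.
have Eu : nodes m = nodes n.
  apply/fsetP => x; apply/idP/idP => [/(extends_lift mn)[y yn ->]|xn].
    by rewrite tk.
  by rewrite -(tk x xn) (extends_nodes mn).
have Ev i x y : (x, y) \in offdiag (nodes n) ->
    hv m i x y = hv n i x y /\ gv m i x y = gv n i x y.
  move=> xy; have := xy; rewrite offdiagE => /and3P[xn yn nxy].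
  have := mnv x y xy; rewrite (tk x) // (tk y) // => /(_ nxy i)[-> ->]; split=> //.
  by case: Mn => _ _ /(_ i _ _ xy)[_ gs] _ _; rewrite El take_oversize // gs.
have dm i := let: And5 _ d _ _ _ := Mm in d i.
have dn i := let: And5 _ d _ _ _ := Mn in d i.
have Eh : hfun m = hfun n.
  apply/ffunP => i; apply: (@fmap_odflt_inj _ _ 0).
    by rewrite (proj1 (dm i)) (proj1 (dn i)) Eu.
  move=> [x y] xy; have [|hE gE] := Ev i x y; [by rewrite -(proj1 (dn i))|].
  exact: hE.
have Eg : gfun m = gfun n.
  apply/ffunP => i; apply: (@fmap_odflt_inj _ _ [::]).
    by rewrite (proj2 (dm i)) (proj2 (dn i)) Eu.
  move=> [x y] xy; have [|hE gE] := Ev i x y; [by rewrite -(proj2 (dn i))|].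
  exact: gE.
clear -El Eu Eh Eg; case: m El Eu Eh Eg => l u h g /=.
by case: n => l' u' h' g' /= -> -> -> ->.
Qed.

Lemma extends_trans n m p : extends m n -> extends n p -> extends m p.
Proof.
move=> mn np; case: (mn) (np) => lmn _ vmn [lnp _ vnp].
have tt (s : seq bool) : take (lev m) (take (lev n) s) = take (lev m) s by rewrite take_takel.
split; first exact: leq_trans lnp.
  apply/fsetP => x; apply/idP/imfsetP => /= [|[y yp ->]].
    move=> /(extends_lift mn)[y yn ->].
    by have [z zp ->] := extends_lift np yn; exists z.
  by rewrite -(tt y); apply/(extends_nodes mn)/(extends_nodes np).
move=> x y xy nxy i; have := xy; rewrite offdiagE => /and3P[xp yp _].
have nxy' : take (lev n) x != take (lev n) y.
  by apply: contraNneq nxy => E; rewrite -(tt x) -(tt y) E.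
have [hE gE] := vnp x y xy nxy' i.
have xy' : (take (lev n) x, take (lev n) y) \in offdiag (nodes n).
  by rewrite offdiagE !(extends_nodes np).
have := vmn _ _ xy'; rewrite !tt => /(_ nxy i)[-> ->].
by rewrite hE gE tt.
Qed.

Lemma ndrk_ge_limitP a m (la : olimit a) :
  ndrk_ge T a m <-> forall b, olt b a -> ndrk_ge T b m.
Proof.
split=> [|H]; last exact: ndrk_ge_limit.
move=> H; case: H la => {a m} [m [] //|//|b m _ [_ /(_ b)] //].
Qed.

Lemma ndrk_ge_succP b m : ndrk_ge T (osucc b) m <->
  forall x, x \in nodes m -> exists n,
    [/\ inM T n, (lev m < lev n)%N, extends m n, ndrk_ge T b n & splits n x].
Proof.
split=> [|H]; last exact: ndrk_ge_succ.
move Ea: (osucc b) => a H.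
case: H Ea => {a m} [m /osucc_neq0 //|a m [_ la] _ E|c m H].
  by case: (la b).
by move=> /osucc_inj ->.
Qed.

Lemma ndrk_ge_sim (R : tup iot -> tup iot -> Prop) :
  (forall m m' x', R m m' -> x' \in nodes m' -> exists2 x, x \in nodes m &
    forall n, inM T n -> (lev m < lev n)%N -> extends m n -> splits n x ->
    exists n', [/\ R n n', inM T n', (lev m' < lev n')%N, extends m' n' &
      splits n' x']) ->
  forall a m m', R m m' -> ndrk_ge T a m -> ndrk_ge T a m'.
Proof.
move=> sim; elim/ON_ind => [|b IH|a la IH] m m' mm'.
- by move=> _; apply: ndrk_ge_zero.
- move=> /ndrk_ge_succP H; apply/ndrk_ge_succP => x' x'm'.
  have [x xm lift] := sim m m' x' mm' x'm'.
  have [n [Mn mn emn bn sn]] := H x xm.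
  have [n' [nn' Mn' mn' emn' sn']] := lift n Mn mn emn sn.
  by exists n'; split=> //; apply: IH bn.
- move=> /(ndrk_ge_limitP _ la) H; apply/(ndrk_ge_limitP _ la) => b ba.
  exact: IH (H b ba).
Qed.

Lemma extends_ndrk_ge m n a : inM T m -> inM T n -> extends m n ->
  ndrk_ge T a n -> ndrk_ge T a m.
Proof.
pose R n m := [/\ inM T m, inM T n & extends m n].
move=> Mm Mn mn; apply: (@ndrk_ge_sim R); last by split.
move=> {}n {Mm Mn mn}m x [Mm Mn mn] xm; have [y yn xy] := extends_lift mn xm.
exists y => // p Mp lnp np /(splitsP Mp); rewrite (inM_size Mn) // => /(_ lnp).
case=> z [t [zp tp zt yz yt]].
have lmn : (lev m <= lev n)%N by case: mn.
have lmp := leq_ltn_trans lmn lnp.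
exists p; split=> //; first by split=> //; apply: extends_refl.
  exact: extends_trans np.
apply/splitsP => //; rewrite (inM_size Mm) //.
exists z, t; split=> //; rewrite xy.
  by rewrite -[in RHS]yz take_takel.
by rewrite -[in RHS]yt take_takel.
Qed.

Lemma inM_node m : inM T m -> exists x, x \in nodes m.
Proof. by case=> -[_ _ /card_fset_gt1P[x [y [xm _ _]]]] _ _ _ _; exists x. Qed.

Lemma ndrk_ge_lt a b m : inM T m -> olt b a -> ndrk_ge T a m -> ndrk_ge T b m.
Proof.
move=> Mm; elim/ON_ind: a b => [|c IH|a la _] b ba.
- by case: (@olt_irr b); apply: olt_le_trans (ozero_le b).
- move=> /ndrk_ge_succP H; have [x xm] := inM_node Mm.
  have [n [Mn _ mn cn _]] := H x xm.
  have cm := extends_ndrk_ge Mm Mn mn cn.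
  have [->//|nbc] := pselect (b = c); apply: IH cm.
  by apply: ole_neq_lt nbc; apply/olt_succ.
- by move=> /(ndrk_ge_limitP _ la); apply.
Qed.

Lemma ndrk_ge_le a b m : inM T m -> ole b a -> ndrk_ge T a m -> ndrk_ge T b m.
Proof.
move=> Mm ba; have [->//|nab] := pselect (b = a).
exact/ndrk_ge_lt/ole_neq_lt.
Qed.

Lemma ndrk_geP a m : inM T m -> xle (Ord a) (ndrk T m) <-> ndrk_ge T a m.
Proof.
move=> Mm; rewrite /ndrk; case: pselect => [all|nall]; first by split.
have [|gm gmax] := @ogreatestP (fun a => ndrk_ge T a m).
  move: nall => /existsNP[b0]; elim/ON_ind: b0 => [|b IH|b lb IH] nb.
  - by case: nb; apply: ndrk_ge_zero.
  - have [bm|/IH//] := pselect (ndrk_ge T b m); exists b; split=> // c cm.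
    have [//|bc] := ole_or_lt c b.
    by case: nb; apply: ndrk_ge_le cm => //; apply/osucc_le.
  - have [[c cb nc]|nex] := pselect (exists2 c, olt c b & ~ ndrk_ge T c m).
      exact: IH nc.
    case: nb; apply/ndrk_ge_limitP => // c cb; apply: contrapT => nc.
    by apply: nex; exists c.
by split=> [am|/gmax//]; apply: ndrk_ge_le gm.
Qed.

Lemma ndrk_le m n : inM T m -> inM T n ->
  (forall a, ndrk_ge T a m -> ndrk_ge T a n) -> xle (ndrk T m) (ndrk T n).
Proof.
move=> Mm Mn H; case E: (ndrk T m) => [a|].
  by apply/ndrk_geP => //; apply/H/ndrk_geP => //; rewrite E; apply: ole_refl.
case F: (ndrk T n) => [b|//]; case: (@olt_irr b).
have : xle (Ord (osucc b)) (ndrk T n).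
  by apply/ndrk_geP => //; apply/H/ndrk_geP => //; rewrite E.
by rewrite F => /osucc_le.
Qed.

Lemma trans_offdiagP m rho (e : seq bool * seq bool) : inM T m -> size rho = lev m ->
  e \in offdiag (trans_nodes m rho) ->
  exists x y, (x, y) \in offdiag (nodes m) /\ e = (badd x rho, badd y rho).
Proof.
case: e => p q Mm sr; rewrite offdiagE => /and3P[/imfsetP[x /= xm ->]].
move=> /imfsetP[y /= ym ->] xy; exists x, y; rewrite offdiagE xm ym; split=> //.
by apply: contraNneq xy => ->.
Qed.

Lemma trans_offdiag m rho x y : inM T m -> size rho = lev m ->
  (x, y) \in offdiag (nodes m) ->
  (badd x rho, badd y rho) \in offdiag (trans_nodes m rho).
Proof.
move=> Mm sr; rewrite !offdiagE => /and3P[xm ym xy].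
have tr z : z \in nodes m -> badd z rho \in trans_nodes m rho.
  exact: in_imfset.
rewrite !tr //=; apply: contraNneq xy => E; apply/eqP.
by rewrite -(@baddK x rho) ?E ?baddK // sr (inM_size Mm).
Qed.

Lemma translate_hgv m rho i x y : inM T m -> size rho = lev m ->
  (x, y) \in offdiag (nodes m) ->
  hv (translate m rho) i (badd x rho) (badd y rho) = hv m i x y /\
  gv (translate m rho) i (badd x rho) (badd y rho) = gv m i x y.
Proof.
move=> Mm sr xy; have xyt := trans_offdiag Mm sr xy.
move: xy; rewrite offdiagE => /and3P[xm ym _].
rewrite {1}/hv {1}/gv /= !ffunE !in_fnd /= !ffunE /=.
by rewrite !baddK // sr (inM_size Mm).
Qed.

Lemma inM_translate m rho : inM T m -> size rho = lev m ->
  inM T (translate m rho).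
Proof.
move=> Mm sr; case: (Mm) => -[l0 _ u2] _ mc md me.
split; first split=> //.
- move=> x /imfsetP[y /= ym ->].
  by rewrite size_badd ?sr (inM_size Mm ym).
- move: u2 => /card_fset_gt1P[x [y [xm ym xy]]]; apply/card_fset_gt1P.
  exists (badd x rho), (badd y rho).
  have := @trans_offdiag m rho x y Mm sr.
  by rewrite !offdiagE xm ym xy => /(_ isT)/and3P[].
- by move=> i; rewrite /= !ffunE.
- move=> i _ _ /(trans_offdiagP Mm sr)[x [y [xy [-> ->]]]].
  by have [-> ->] := translate_hgv i Mm sr xy; apply: mc.
- move=> i _ _ /(trans_offdiagP Mm sr)[x [y [xy [-> ->]]]].
  have yx : (y, x) \in offdiag (nodes m).
    by move: xy; rewrite !offdiagE eq_sym => /and3P[-> -> ->].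
  have [_ ->] := translate_hgv i Mm sr xy.
  have [_ ->] := translate_hgv i Mm sr yx.
  by rewrite -!(baddC rho) -!baddA md.
- move=> _ _ /(trans_offdiagP Mm sr)[x [y [xy [-> ->]]]].
  have yx : (y, x) \in offdiag (nodes m).
    by move: xy; rewrite !offdiagE eq_sym => /and3P[-> -> ->].
  rewrite /image_mem (eq_map (fun i => proj2 (translate_hgv i Mm sr xy))).
  by rewrite (eq_map (fun i => proj2 (translate_hgv i Mm sr yx))) me.
Qed.

Lemma inM_translateN m rho : inM T m -> inM T (translateN m rho).
Proof. by move=> Mm; apply: inM_translate; rewrite ?size_mkseq. Qed.

Lemma take_mkseq (rho : nat -> bool) l k : (l <= k)%N ->
  take l (mkseq rho k) = mkseq rho l.
Proof. by move=> lk; rewrite /mkseq -map_take take_iota (minn_idPl lk). Qed.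

Lemma extends_translateN m n rho : inM T m -> inM T n -> extends m n ->
  extends (translateN m rho) (translateN n rho).
Proof.
move=> Mm Mn mn; case: (mn) => lmn _ v.
have sm : size (mkseq rho (lev m)) = lev m by rewrite size_mkseq.
have sn : size (mkseq rho (lev n)) = lev n by rewrite size_mkseq.
have tk x : take (lev m) (badd x (mkseq rho (lev n))) =
    badd (take (lev m) x) (mkseq rho (lev m)).
  by rewrite take_badd take_mkseq.
split=> //=.
  apply/fsetP => x; apply/imfsetP/imfsetP => /= -[y].
    move=> /(extends_lift mn)[z zn ->] ->.
    by exists (badd z (mkseq rho (lev n))); rewrite ?tk //; apply: in_imfset.
  move=> /imfsetP[z /= zn ->] ->.
  by exists (take (lev m) z); rewrite ?tk // (extends_nodes mn).
move=> _ _ /(trans_offdiagP Mn sn)[x [y [xy [-> ->]]]]; rewrite !tk => nxy i.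
have {}nxy : take (lev m) x != take (lev m) y by apply: contraNneq nxy => ->.
have xym : (take (lev m) x, take (lev m) y) \in offdiag (nodes m).
  move: xy; rewrite !offdiagE nxy => /and3P[xn yn _].
  by rewrite !(extends_nodes mn).
have [-> ->] := translate_hgv i Mm sm xym.
have [-> ->] := translate_hgv i Mn sn xy.
exact: v.
Qed.

Lemma extends_translateNK m rho : inM T m ->
  extends m (translateN (translateN m rho) rho).
Proof.
move=> Mm; have sm : size (mkseq rho (lev m)) = lev m by rewrite size_mkseq.
have Mt := inM_translateN rho Mm.
have K x : x \in nodes m ->
    take (lev m) (badd (badd x (mkseq rho (lev m))) (mkseq rho (lev m))) = x.
  by move=> xm; rewrite baddK ?take_oversize // ?sm (inM_size Mm).
split=> //=.
  apply/fsetP => x; apply/idP/imfsetP => /= [xm|[y]].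
    by exists (badd (badd x (mkseq rho (lev m))) (mkseq rho (lev m)));
      rewrite ?K //; do 2![apply: in_imfset => /=].
  by move=> /imfsetP[_ /= /imfsetP[y' /= ym ->] ->] ->; rewrite K.
move=> _ _ /(trans_offdiagP Mt sm)[x' [y' [xyt [-> ->]]]] _ i; have [-> ->] := translate_hgv i Mt sm xyt.
move: xyt => /(trans_offdiagP Mm sm)[x [y [xy [-> ->]]]].
have [-> ->] := translate_hgv i Mm sm xy.
have := xy; rewrite offdiagE => /and3P[xm ym _]; rewrite (K x) // (K y) //; split=> //.
by case: Mm => _ _ /(_ i _ _ xy)[_ gs] _ _; rewrite take_oversize // gs.
Qed.

Lemma splits_translateN m n rho x : inM T m -> inM T n -> (lev m < lev n)%N ->
  x \in nodes m -> splits n x ->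
  splits (translateN n rho) (badd x (mkseq rho (lev m))).
Proof.
move=> Mm Mn lmn xm; have sx := inM_size Mm xm.
rewrite (splitsP Mn) ?sx // => -[y [z [yn zn yz xy xz]]].
have sb : size (badd x (mkseq rho (lev m))) = lev m.
  by rewrite size_badd ?size_mkseq.
rewrite (splitsP (inM_translateN rho Mn)) sb //.
have := @trans_offdiag n (mkseq rho (lev n)) y z Mn.
rewrite size_mkseq !offdiagE yn zn yz => /(_ erefl isT)/and3P[yt zt nyz].
exists (badd y (mkseq rho (lev n))), (badd z (mkseq rho (lev n))).
by split=> //; rewrite take_badd (take_mkseq _ (ltnW lmn)) ?xy ?xz.
Qed.

Lemma ndrk_ge_translateN m rho a : inM T m ->
  ndrk_ge T a m -> ndrk_ge T a (translateN m rho).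
Proof.
pose R m m' := inM T m /\ m' = translateN m rho.
move=> Mm; apply: (@ndrk_ge_sim R) => //.
move=> {Mm}m _ _ [Mm ->] /imfsetP[x /= xm ->]; exists x => // n Mn lmn mn sn.
exists (translateN n rho); split=> //.
- exact: inM_translateN.
- exact: extends_translateN.
- exact: splits_translateN sn.
Qed.

Lemma ndrk_translateN m rho : inM T m -> ndrk T (translateN m rho) = ndrk T m.
Proof.
move=> Mm; have Mt := inM_translateN rho Mm.
apply: xle_anti; apply: ndrk_le => // a; last exact: ndrk_ge_translateN.
move=> /(ndrk_ge_translateN rho Mt).
exact: (extends_ndrk_ge Mm (inM_translateN rho Mt) (extends_translateNK rho Mm)).
Qed.

Lemma offdiagS (u v : {fset seq bool}) x y : u `<=` v ->
  (x, y) \in offdiag u -> (x, y) \in offdiag v.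
Proof.
by move=> /fsubsetP uv; rewrite !offdiagE => /and3P[/uv-> /uv-> ->].
Qed.

Lemma restrict_hgv m u i x y : (x, y) \in offdiag u ->
  hv (restrict m u) i x y = hv m i x y /\ gv (restrict m u) i x y = gv m i x y.
Proof. by move=> xy; rewrite /hv /gv /= !ffunE !fnd_restrict xy. Qed.

Lemma inM_restrict m (u : {fset seq bool}) : inM T m -> u `<=` nodes m ->
  (2 <= #|` u|)%N -> inM T (restrict m u).
Proof.
move=> Mm um u2; case: (Mm) => -[l0 su _] dom mc md me.
have yx x y : (x, y) \in offdiag u -> (y, x) \in offdiag u.
  by rewrite !offdiagE eq_sym => /and3P[-> -> ->].
have sub : offdiag u `<=` offdiag (nodes m).
  by apply/fsubsetP => -[x y]; apply: offdiagS.
split; first split=> //.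
- by move=> x /(fsubsetP um); apply: su.
- move=> i; have [dh dg] := dom i.
  by rewrite /= !ffunE !domf_restrict dh dg; split; apply/fsetIidPl.
- move=> i x y xy; have [-> ->] := restrict_hgv m i xy.
  exact/mc/(offdiagS um).
- move=> i x y xy; have [_ ->] := restrict_hgv m i xy.
  by have [_ ->] := restrict_hgv m i (yx _ _ xy); apply/md/(offdiagS um).
- move=> x y xy; rewrite /image_mem (eq_map (fun i => proj2 (restrict_hgv m i xy))).
  rewrite (eq_map (fun i => proj2 (restrict_hgv m i (yx _ _ xy)))).
  exact/me/(offdiagS um).
Qed.

Lemma ndrk_ge_restrict m (u : {fset seq bool}) a : inM T m -> u `<=` nodes m ->
  (2 <= #|` u|)%N -> ndrk_ge T a m -> ndrk_ge T a (restrict m u).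
Proof.
move=> Mm um u2; pose R m m' := exists u : {fset seq bool},
  [/\ inM T m, u `<=` nodes m, (2 <= #|` u|)%N & m' = restrict m u].
apply: (@ndrk_ge_sim R); last by exists u.
move=> {u2 um Mm u}m _ x [u [Mm um u2 ->]] /= xu.
have xm := fsubsetP um x xu; exists x => // n Mn lmn mn.
pose v := [fset y in nodes n | take (lev m) y \in u].
have vn : v `<=` nodes n by apply/fsubsetP => y; rewrite !inE => /andP[].
have lift y : y \in u -> exists2 z, z \in v & y = take (lev m) z.
  move=> yu; have [z zn yz] := extends_lift mn (fsubsetP um y yu).
  by exists z; rewrite // !inE zn -yz.
have v2 : (2 <= #|` v|)%N.
  move: u2 => /card_fset_gt1P[y [z [/lift[y' y'v ->] /lift[z' z'v ->] yz]]].
  apply/card_fset_gt1P; exists y', z'; split=> //.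
  by apply: contraNneq yz => ->.
have Mr := inM_restrict Mn vn v2.
rewrite (splitsP Mn) (inM_size Mm) // => -[y [z [yn zn yz xy xz]]].
exists (restrict n v); split=> //; first by exists v.
  split=> /=; first exact: ltnW.
    apply/fsetP => y'; apply/idP/imfsetP => /= [/lift[z' z'v ->]|[z' + ->]].
      by exists z'.
    by rewrite !inE => /andP[].
  move=> y' z' yzv nyz i; have [-> ->] := restrict_hgv n i yzv.
  have yzu : (take (lev m) y', take (lev m) z') \in offdiag u.
    move: yzv; rewrite !offdiagE nyz !inE.
    by move=> /and3P[/andP[_ ->] /andP[_ ->]].
  have [-> ->] := restrict_hgv m i yzu.
  by case: mn => _ _; apply=> //; apply: offdiagS yzv.
apply/(splitsP Mr); rewrite (inM_size Mm) //=.
by exists y, z; split=> //; rewrite !inE ?yn ?zn ?xy ?xz.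
Qed.

Lemma ndrk_ge_omega1_split m x : inM T m -> x \in nodes m ->
  ndrk_ge T omega1 m -> exists n, [/\ inM T n, (lev m < lev n)%N, extends m n,
    ndrk_ge T omega1 n & splits n x].
Proof.
move=> Mm xm mw; apply: contrapT => nex.
pose S : set (tup iot) :=
  [set n | [/\ inM T n, (lev m < lev n)%N, extends m n & splits n x]]%classic.
have small n : S n -> exists2 b, ndrk T n = Ord b & olt b omega1.
  move=> [Mn lmn mn sn]; have nw : ~ ndrk_ge T omega1 n.
    by move=> nw; apply: nex; exists n.
  move: nw; rewrite -ndrk_geP //; case: (ndrk T n) => [b|] //= nw; exists b => //.
  by have [|] := ole_or_lt omega1 b.
have cover : ([set a | olt a omega1] `<=`
    \bigcup_(n in S) [set a | xle (Ord a) (ndrk T n)])%classic.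
  move=> a /= aw.
  have /ndrk_ge_succP/(_ x xm)[n [Mn lmn mn an sn]] : ndrk_ge T (osucc a) m.
    by apply: ndrk_ge_lt mw => //; apply: osucc_omega1.
  by exists n => //=; apply/ndrk_geP.
apply: (proj1 omega1P); apply: sub_countable (subset_card_le cover) _.
apply: bigcup_countable; first exact: countable_tup.
by move=> n /small[b -> bw]; apply: countable_ole.
Qed.

Lemma ndrk_ge_omega1_all a m : inM T m -> ndrk_ge T omega1 m -> ndrk_ge T a m.
Proof.
elim/ON_ind: a m => [|b IH|a la IH] m Mm mw.
- exact: ndrk_ge_zero.
- apply/ndrk_ge_succP => x xm.
  have [n [Mn lmn mn nw sn]] := ndrk_ge_omega1_split Mm xm mw.
  by exists n; split=> //; apply: IH.
- by apply/ndrk_ge_limitP => // b ba; apply: IH.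
Qed.

Lemma ndrk_intermediate m a b : inM T m -> ndrk T m = Ord b -> olt a b ->
  exists n, [/\ inM T n, extends m n & ndrk T n = Ord a].
Proof.
elim: (olt_wf b) m => {}b _ IH m Mm mb ab.
have [x xm nox] : exists2 x, x \in nodes m & ~ exists n, [/\ inM T n,
    (lev m < lev n)%N, extends m n, ndrk_ge T b n & splits n x].
  apply: contrapT => nex; case: (@olt_irr b); apply/osucc_le.
  suff : xle (Ord (osucc b)) (ndrk T m) by rewrite mb.
  apply/ndrk_geP => //; apply/ndrk_ge_succP => x xm; apply: contrapT => nox.
  by apply: nex; exists x.
have /ndrk_ge_succP/(_ x xm)[n [Mn lmn mn an sn]] : ndrk_ge T (osucc a) m.
  by apply/ndrk_geP => //; rewrite mb; apply/osucc_le.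
have nbn : ~ xle (Ord b) (ndrk T n).
  by rewrite ndrk_geP // => bn; apply: nox; exists n.
move: an; rewrite -ndrk_geP //; case nc: (ndrk T n) nbn => [c|] //= nbc ac.
have [ca|nac] := pselect (a = c); first by exists n; rewrite ca.
have cb : olt c b by have [|] := ole_or_lt b c.
have [p [Mp np pa]] := IH c cb n Mn nc (ole_neq_lt ac nac).
by exists p; split=> //; apply: extends_trans np.
Qed.

Lemma NDRK_omega1 : xle (Ord omega1) (NDRK iot T) -> NDRK iot T = Inf.
Proof.
rewrite /NDRK /xsup; case: pselect => // -[c cub] cw; exfalso.
have [cb cleast] := @oleastP [set a | forall x, (exists2 m : tup iot, inM T m &
  x = xsucc (ndrk T m)) -> xle x (Ord a)]%classic (ex_intro _ c cub).
have small m : inM T m -> exists2 b, ndrk T m = Ord b & olt b omega1.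
  move=> Mm; case E: (ndrk T m) => [b|]; last first.
    by have := cub _ (ex_intro2 _ _ m Mm erefl); rewrite E.
  exists b => //; have [wb|//] := ole_or_lt omega1 b.
  have mw : ndrk_ge T omega1 m by apply/ndrk_geP => //; rewrite E.
  case: (@olt_irr b); apply/osucc_le.
  suff : xle (Ord (osucc b)) (ndrk T m) by rewrite E.
  exact/ndrk_geP/ndrk_ge_omega1_all.
apply: (proj1 omega1P).
have cover : ([set a | olt a omega1] `<=`
    \bigcup_(m in [set m : tup iot | inM T m]) [set a | xle (Ord a) (ndrk T m)])%classic.
  move=> a /= aw; apply: contrapT => nex; case: (@olt_irr a).
  apply: olt_le_trans aw (ole_trans cw (cleast a _)) => x [m Mm ->].
  have [b mb _] := small m Mm; rewrite mb /= osucc_le.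
  have [ab|//] := ole_or_lt a b.
  by case: nex; exists m => //=; rewrite mb.
apply: sub_countable (subset_card_le cover) _.
apply: bigcup_countable; first exact: countable_tup.
by move=> m /small[b -> bw]; apply: countable_ole.
Qed.

End Tuples.

Theorem lemma3p10 (T : nat -> seq bool -> Prop) (iot : nat)
    (hT : forall n, is_tree (T n) /\ no_maximal (T n)) (hiot : 2 <= iot) :
  (* (1) *)
  ((forall m : tup iot, inM T m -> extends m m) /\
   (forall m n : tup iot, inM T m -> inM T n ->
      extends m n -> extends n m -> m = n) /\
   (forall m n p : tup iot, inM T m -> inM T n -> inM T p ->
      extends m n -> extends n p -> extends m p)) /\
  (* (2) *)
  (forall (m n : tup iot) (a : ON), inM T m -> inM T n -> extends m n ->
     xle (Ord a) (ndrk T n) -> xle (Ord a) (ndrk T m)) /\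
  (* (3) *)
  ((forall (m : tup iot) (a b : ON), inM T m ->
      olt b a -> ndrk_ge T a m -> ndrk_ge T b m) /\
   (forall (m : tup iot) (a : ON), inM T m ->
      (xle (Ord a) (ndrk T m) <-> ndrk_ge T a m))) /\
  (* (4) *)
  (forall (m : tup iot) (rho : nat -> bool), inM T m ->
     inM T (translateN m rho) /\ ndrk T m = ndrk T (translateN m rho)) /\
  (* (5) *)
  (forall (m : tup iot) (x : seq bool), inM T m -> x \in nodes m ->
     xle (Ord omega1) (ndrk T m) ->
     exists n : tup iot,
       [/\ inM T n, extends m n, xle (Ord omega1) (ndrk T n) & splits n x]) /\
  (* (6) *)
  (forall (m : tup iot) (a b : ON), inM T m -> ndrk T m = Ord b -> olt a b ->
     exists n : tup iot, [/\ inM T n, extends m n & ndrk T n = Ord a]) /\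
  (* (7) *)
  (xle (Ord omega1) (NDRK iot T) -> NDRK iot T = Inf) /\
  (* (8) *)
  (forall (m : tup iot) (u : {fset seq bool}), inM T m ->
     (u `<=` nodes m)%fset -> 2 <= #|` u|%fset ->
     inM T (restrict m u) /\ xle (ndrk T m) (ndrk T (restrict m u))).
Proof.
split.
  split; first exact: extends_refl.
  split; first exact: extends_anti.
  by move=> m n p _ _ _; apply: extends_trans.
split.
  move=> m n a Mm Mn mn; rewrite !ndrk_geP //.
  exact: extends_ndrk_ge mn.
split.
  split=> [m a b|m a]; [exact: ndrk_ge_lt | exact: ndrk_geP].
split.
  move=> m rho Mm; split; first exact: inM_translateN.
  by rewrite ndrk_translateN.
split.
  move=> m x Mm xm /(ndrk_geP _ Mm) mw.
  have [n [Mn _ mn nw sn]] := ndrk_ge_omega1_split Mm xm mw.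
  by exists n; split=> //; apply/ndrk_geP.
split; first exact: ndrk_intermediate.
split; first exact: NDRK_omega1.
move=> m u Mm um u2; have Mr := inM_restrict Mm um u2; split=> //.
by apply: ndrk_le => // a; apply: ndrk_ge_restrict.
Qed.
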